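(* Let $K$ be a field of characteristic $0$, $d,m_1,\ldots,m_d$ positive integers, $\boldsymbol{\alpha}=(\alpha_1,\ldots,\alpha_d)\in K^d$ with $\alpha_1=0$, $\mathcal{I}=\{(i,s):1\le i\le d,\ 1\le s\le m_i+1\}\setminus\{(1,1)\}$ and $M=d-1+\sum_i m_i$. Let $\ell,n$ be integers with $n\ge0$ and $0\le\ell\le M$, and define \[ A_{n,\ell}(z)=(-1)^\ell\frac{(z)_\ell}{\ell!}\prod_{i=1}^d\Big((-1)^n\frac{(z+\alpha_i)_n}{n!}\Big)^{m_i+1},\quad P_{n,\ell}(z)=\Delta_{-1}^n\big(A_{n,\ell}(z)\big), \] \[ Q_{n,i,s,\ell}(z)=\varphi_{\alpha_i,s}\Big(\frac{P_{n,\ell}(z)-P_{n,\ell}(t)}{z-t}\Big)\quad((i,s)\in\mathcal{I}). \] Then: (i) $\big(P_{n,\ell}(z),Q_{n,i,s,\ell}(z)\big)_{(i,s)\in\mathcal{I}}$ is a weight $(n,\ldots,n)\in\mathbb{N}^M$ Padé-type approximant of $\big(R_{\alpha_i,s}(z)\big)_{(i,s)\in\mathcal{I}}$. (ii) We have \[ P_{n,\ell}(z)=\sum_{k=0}^n\binom nk(-1)^{n-k+\ell}\frac{(z-k)_\ell}{\ell!}A_{n,0}(z-k)=\sum_{j=0}^{Mn+\ell}p_{n,j,\ell}\frac{(z)_j}{j!}, \] \[ Q_{n,i,s,\ell}(z)=\sum_{j=1}^{Mn+\ell}p_{n,j,\ell}\Big(\sum_{k=0}^{j-1}\frac{(-1)^{k+1}a_{i,s,k}\,k!}{(z)_{k+1}}\Big)\frac{(z)_j}{j!},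 \] where $p_{n,j,\ell}=\sum_{k=n}^{j+n}\binom{j+n}{k}(-1)^{n-k}\binom k\ell\prod_{r=1}^d\binom{k-\alpha_r}{n}^{m_r+1}$. (iii) For each $(i,s)\in\mathcal{I}$, the Laurent series $\mathfrak{R}_{n,i,s,\ell}(z)=P_{n,\ell}(z)R_{\alpha_i,s}(z)-Q_{n,i,s,\ell}(z)$ satisfies \[ \mathfrak{R}_{n,i,s,\ell}(z)=\sum_{k=n}^\infty\frac{k!}{(k-n)!}\,\frac{\varphi_{\alpha_i,s}\big((t+n)_{k-n}A_{n,\ell}(t)\big)}{z(z+1)\cdots(z+k)}. \]
   Context: $(x)_n=x(x+1)\cdots(x+n-1)$, $(x)_0=1$; $\binom{\alpha}{k}=\alpha(\alpha-1)\cdots(\alpha-k+1)/k!$ for $\alpha\in K$. $\Delta_{-1}$ acts on $K[z]$ by $\Delta_{-1}P(z)=P(z-1)-P(z)$. Rational functions such as $1/(z(z+1)\cdots(z+k))$ and $1/(z)_{k+1}$ are viewed in $K((1/z))$ by expansion in powers of $1/z$; $\operatorname{ord}_\infty(\sum_k a_kz^{-k})=\min\{k:a_k\ne0\}$. For $f=\sum_{k\ge0}f_kz^{-k-1}\in(1/z)K[[1/z]]$, $\varphi_f:K[t]\to K$ is the $K$-linear map with $t^k\mapsto f_k$, extended $K[z]$-linearly to $K[z,t]\to K[z]$ (acting on $t$ only). Modified inverse Mellin transform: for $g\in K[[z]]$ write $g(e^z-1)=\sum_{k\ge0}b_kz^k/k!$ and set $\mathcal{M}^{-1}(g)=\sum_{k\ge0}b_k(-1/z)^{k+1}$.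 With $(1+z)^\alpha=\sum_k\binom\alpha kz^k$ and $\log(1+z)=\sum_{n\ge1}(-1)^{n-1}z^n/n$, put $g_{i,s}(z)=(1+z)^{\alpha_i}\log^{s-1}(1+z)/z$ if $s\ge2$ and $g_{i,1}(z)=((1+z)^{\alpha_i}-1)/z$ if $i\ge2$; write $g_{i,s}(z)=\sum_{k\ge0}a_{i,s,k}z^k$, and $R_{\alpha_i,s}=\mathcal{M}^{-1}(g_{i,s})\in(1/z)K[[1/z]]$, $\varphi_{\alpha_i,s}=\varphi_{R_{\alpha_i,s}}$. A weight $(n,\ldots,n)$ Padé-type approximant of $(f_{i,s})_{(i,s)\in\mathcal{I}}$ is a nonzero vector of polynomials $(P,(Q_{i,s}))\in K[z]^{M+1}$ with $\operatorname{ord}_\infty(Pf_{i,s}-Q_{i,s})\ge n+1$ for all $(i,s)$. *)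

(* Defs.v *)
From HB Require Import structures.
From mathcomp Require Import all_boot all_order all_algebra.
From mathcomp Require Import zify.
From mathcomp Require Import boolp classical_sets functions constructive_ereal.

Set Implicit Arguments.
Unset Strict Implicit.
Unset Printing Implicit Defensive.

Import Order.TTheory GRing.Theory Num.Theory.
Local Open Scope ring_scope.

(* A formal power series \sum_k f_k z^k is its sequence f : nat -> K of
   coefficients. *)
Section PowerSeries.
Variable K : fieldType.
Implicit Types (f g h : nat -> K) (a : K).

Definition fps_one : nat -> K := fun k => (k == 0%N)%:R.

Definition fps_mul f g : nat -> K := fun k => \sum_(i < k.+1) f i * g (k - i)%N.

Definition fps_exp f (n : nat) : nat -> K := iter n (fps_mul f) fps_one.

(* g(h(z)); meaningful when h 0 = 0, so that h^i has no term of degree < i and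
   the sum may be cut at i = k. *)
Definition fps_comp g h : nat -> K :=
  fun k => \sum_(i < k.+1) g i * fps_exp h i k.

(* f(z) / z when f 0 = 0. *)
Definition fps_divz f : nat -> K := fun k => f k.+1.

(* Multiplicative inverse when f 0 != 0: the geometric series
   f_0^-1 \sum_i (1 - f / f_0)^i. *)
Definition fps_inv f : nat -> K :=
  fun k => (f 0%N)^-1 *
    fps_comp (fun=> 1) (fun i => fps_one i - f i / f 0%N) k.

Definition gbinom a (k : nat) : K := (\prod_(i < k) (a - i%:R)) / k`!%:R.

(* (1+z)^a *)
Definition fps_pow1p a : nat -> K := gbinom a.

(* log(1+z) *)
Definition fps_log1p : nat -> K :=
  fun k => if k is n.+1 then (-1) ^+ n / n.+1%:R else 0.

(* e^z - 1 *)
Definition fps_expm1 : nat -> K := fun k => if k is 0%N then 0 else (k`!%:R)^-1.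

Lemma fps_exp_eq0 h i k : h 0%N = 0 -> (k < i)%N -> fps_exp h i k = 0.
Proof.
move=> h0; elim: i k => // i IH k ki; rewrite /= /fps_mul big1 // => -[j /= jk] _.
case: j jk => [|j] jk; first by rewrite h0 mul0r.
by rewrite -/(fps_exp h i) IH ?mulr0 //; case: k ki jk => // k ki jk; lia.
Qed.

Lemma fps_invP f : f 0%N != 0 -> fps_mul f (fps_inv f) =1 fps_one.
Proof.
move=> f0 k; pose h i := fps_one i - f i / f 0%N.
have h0 : h 0%N = 0 by rewrite /h /fps_one divff ?subrr.
have fE i : f i = f 0%N * (fps_one i - h i).
  by rewrite /h opprB addrC subrK mulrCA divff ?mulr1.
have oneM g : \sum_(i < k.+1) fps_one i * g (k - i)%N = g k.
  rewrite big_ord_recl mul1r subn0 big1 ?addr0 // => i _.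
  by rewrite /fps_one mul0r.
transitivity (\sum_(i < k.+1) (fps_exp h i k - fps_exp h i.+1 k)).
  transitivity (\sum_(i < k.+1) \sum_(j < k.+1)
                  (fps_one j - h j) * fps_exp h i (k - j)%N).
    rewrite /fps_mul exchange_big /=; apply: eq_bigr => j _.
    rewrite -big_distrr /= {1}fE /fps_inv /fps_comp mulrACA divff // mul1r.
    congr (_ * _); have le1 : ((k - j).+1 <= k.+1)%N by rewrite ltnS leq_subr.
    rewrite (big_ord_widen _ (fun i => 1 * fps_exp h i (k - j)%N) le1).
    rewrite big_mkcond; apply: eq_bigr => i _; rewrite mul1r.
    by case: ltnP => // hi; rewrite fps_exp_eq0.
  apply: eq_bigr => i _; rewrite -(oneM (fps_exp h i)) -sumrB.
  by apply: eq_bigr => j _; rewrite mulrBl.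
rewrite -(big_mkord xpredT (fun i => fps_exp h i k - fps_exp h i.+1 k)).
rewrite (@telescope_sumr_eq _ 0 k.+1 (fun i => - fps_exp h i k)) //.
  by rewrite (fps_exp_eq0 h0 (ltnSn k)) oppr0 opprK add0r.
by move=> i _; rewrite opprK addrC.
Qed.

End PowerSeries.
Arguments fps_one {K}.
Arguments fps_log1p {K}.
Arguments fps_expm1 {K}.

(* K((1/z)): the series \sum_k f_k z^(-k), k : int, with f_k = 0 for k small
   enough, represented by k |-> f_k. *)
Section Laurent.
Variable K : fieldType.

Definition is_laurent : {pred int -> K} :=
  fun f => `[< exists N : int, forall k, k < N -> f k = 0 >].

Lemma is_laurent_zmod_closed : zmod_closed is_laurent.
Proof.
split; first by apply/asboolP; exists 0.
move=> f g /asboolP [N hN] /asboolP [M hM]; apply/asboolP.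
exists (Num.min N M) => k; rewrite lt_min => /andP[kN kM].
by rewrite -[(f - g) k]/(f k - g k) hN // hM // subrr.
Qed.

HB.instance Definition _ :=
  GRing.isZmodClosed.Build (int -> K) is_laurent is_laurent_zmod_closed.

Record laurent := Laurent {
  lcoef :> int -> K;
  lcoefP : is_laurent lcoef }.

HB.instance Definition _ := [isSub for lcoef].
HB.instance Definition _ := [Choice of laurent by <:].
HB.instance Definition _ := [SubChoice_isSubZmodule of laurent by <:].

Lemma laurent_eqP (f g : laurent) : (forall k, f k = g k) <-> f = g.
Proof. by split=> [fg|->//]; apply/val_inj/funext. Qed.

Lemma lcoefD (f g : laurent) k : (f + g) k = f k + g k.
Proof. by []. Qed.

Lemma lcoefN (f : laurent) k : (- f) k = - f k.
Proof. by []. Qed.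

Lemma lcoefB (f g : laurent) k : (f - g) k = f k - g k.
Proof. by []. Qed.

(* The product of K((1/z)), restricted to K[z] x K((1/z)): the coefficient of
   z^(-k) in P f. *)
Definition lscale_coef (P : {poly K}) (f : int -> K) : int -> K :=
  fun k => \sum_(i < size P) P`_i * f (k + i%:Z).

Lemma lscale_subproof P (f : laurent) : is_laurent (lscale_coef P f).
Proof.
case: f => f /= /asboolP[N hN]; apply/asboolP.
exists (N - (size P)%:Z) => k hk; rewrite /lscale_coef big1 // => i _.
rewrite hN ?mulr0 //; rewrite ltrBrDr in hk; apply: le_lt_trans hk.
by rewrite lerD2l lez_nat ltnW.
Qed.

Definition lscale P f := Laurent (lscale_subproof P f).

Lemma lscaleE n (P : {poly K}) (f : int -> K) k : (size P <= n)%N ->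
  lscale_coef P f k = \sum_(i < n) P`_i * f (k + i%:Z).
Proof.
move=> hn; rewrite /lscale_coef (big_ord_widen _ (fun i => P`_i * f (k + i%:Z)) hn).
rewrite big_mkcond; apply: eq_bigr => i _; case: ltnP => // hi.
by rewrite nth_default // mul0r.
Qed.

Lemma lscaleDr : right_distributive lscale +%R.
Proof.
move=> P f g; apply/laurent_eqP => k.
rewrite lcoefD /= /lscale_coef -big_split /=.
by apply: eq_bigr => i _; rewrite mulrDr.
Qed.

Lemma lscaleDl f : {morph lscale^~ f : P Q / P + Q}.
Proof.
move=> P Q; apply/laurent_eqP => k; rewrite lcoefD /=.
pose n := maxn (size P) (size Q).
rewrite !(@lscaleE n) ?leq_maxl ?leq_maxr ?size_polyD // -big_split /=.
by apply: eq_bigr => i _; rewrite coefD mulrDl.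
Qed.

Lemma lscale0l f : lscale 0 f = 0.
Proof. by apply/laurent_eqP => k /=; rewrite /lscale_coef size_poly0 big_ord0. Qed.

Lemma lscaleC (c : K) (f : int -> K) k : lscale_coef c%:P f k = c * f k.
Proof.
by rewrite (@lscaleE 1) ?size_polyC_leq1 // big_ord1 coefC eqxx addr0.
Qed.

Lemma lscaleMX (P : {poly K}) (f : int -> K) k :
  lscale_coef (P * 'X) f k = lscale_coef P f (k + 1).
Proof.
rewrite (@lscaleE (size P).+1); last first.
  by have := size_polyMleq P 'X; rewrite size_polyX addn2.
rewrite big_ord_recl coefMX mul0r add0r; apply: eq_bigr => i _.
by rewrite coefMX /= /bump /= add1n -addrA intS.
Qed.

Lemma lscaleA P Q f : lscale P (lscale Q f) = lscale (P * Q) f.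
Proof.
elim/poly_ind: P => [|P c IH]; first by rewrite mul0r !lscale0l.
rewrite mulrDl !lscaleDl; congr (_ + _); apply/laurent_eqP => k.
  have -> : P * 'X * Q = P * Q * 'X by rewrite -!mulrA (mulrC 'X).
  by rewrite /= !lscaleMX -[RHS]/(lscale (P * Q) f (k + 1)) -IH.
rewrite /= lscaleC mul_polyC (@lscaleE (size Q) (c *: Q)) ?size_scale_leq //.
by rewrite /lscale_coef big_distrr /=; apply: eq_bigr => i _; rewrite coefZ mulrA.
Qed.

Lemma lscale1 : left_id 1 lscale.
Proof. by move=> f; apply/laurent_eqP => k; rewrite /= lscaleC mul1r. Qed.

(* P *: f is the product P f in K((1/z)), for P : {poly K}. *)
HB.instance Definition _ := GRing.Zmodule_isLmodule.Build {poly K} laurent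
  lscaleA lscale1 lscaleDr lscaleDl.

Lemma lcoefZ P (f : laurent) k :
  (P *: f) k = \sum_(i < size P) P`_i * f (k + i%:Z).
Proof. by []. Qed.

(* \sum_(k >= 0) f_k z^(-v-k) *)
Definition lps_coef (v : nat) (f : nat -> K) : int -> K :=
  fun k => if k is Posz i then (if (v <= i)%N then f (i - v)%N else 0) else 0.

Lemma lps_subproof v f : is_laurent (lps_coef v f).
Proof. by apply/asboolP; exists 0 => -[]. Qed.

Definition lps v f := Laurent (lps_subproof v f).

Definition lpoly_coef (P : {poly K}) : int -> K :=
  fun k => match k with
           | Posz i => if i is 0%N then P`_0 else 0
           | Negz i => P`_i.+1
           end.

Lemma lpoly_subproof P : is_laurent (lpoly_coef P).
Proof.
apply/asboolP; exists (- (size P)%:Z) => -[i|i] /=.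
  by rewrite ltNge lerNl (le_trans (y := 0)) // oppr_le0.
by rewrite NegzE ltrN2 ltz_nat => hi; rewrite nth_default // ltnW.
Qed.

(* The embedding of K[z] in K((1/z)). *)
Definition lpoly P := Laurent (lpoly_subproof P).

(* The expansion of the rational function 1 / D, D != 0: with d = deg D,
   1 / D = z^(-d) / (rev D)(1/z) where rev D is the reversed polynomial. *)
Definition linv (D : {poly K}) : laurent :=
  lps (size D).-1 (fps_inv (fun i => (rev (D : seq K))`_i)).

Lemma linvP D : D != 0 -> D *: linv D = lpoly 1.
Proof.
move=> D0; apply/laurent_eqP => k; rewrite lcoefZ.
have sD : size D = (size D).-1.+1 by rewrite prednK // lt0n size_poly_eq0.
set d := (size D).-1 in sD *; pose r i := (rev (D : seq K))`_i.
have r0 : r 0%N != 0 by rewrite /r nth_rev sD // subn1 -lead_coefE lead_coef_eq0.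
rewrite sD (reindex_inj rev_ord_inj) /=.
transitivity (\sum_(i < d.+1) r i *
   (if k is Posz p then if (i <= p)%N then fps_inv r (p - i)%N else 0 else 0)).
  apply: eq_bigr => -[i /= id] _; rewrite /r nth_rev sD //; congr (_ * _).
  rewrite subSS /lps_coef -/d -/r; case: k => [p|p].
    rewrite -PoszD; have -> : (d <= p + (d - i))%N = (i <= p)%N by lia.
    by case: leqP => // ip; congr (fps_inv r _); lia.
  by case E: (_ + _) => [q|//]; rewrite ifN //; lia.
case: k => [p|p]; last by rewrite big1 /= ?coef1 // => i _; rewrite mulr0.
transitivity (fps_mul r (fps_inv r) p); last first.
  by rewrite fps_invP //; case: p => [|p] //=; rewrite coef1.
pose F i := r i * (if (i <= p)%N then fps_inv r (p - i)%N else 0).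
rewrite -(big_mkord xpredT F) /fps_mul.
transitivity (\sum_(0 <= i < maxn d.+1 p.+1) F i).
  rewrite [RHS](big_cat_nat _ (n := d.+1)) ?leq_maxl //= [X in _ + X]big_nat_cond [X in _ + X]big1 ?addr0 //.
  by move=> i /andP[/andP[di _] _]; rewrite /F /r nth_default ?mul0r // size_rev sD.
rewrite (big_cat_nat _ (n := p.+1)) ?leq_maxr //= [X in _ + X]big_nat_cond [X in _ + X]big1 ?addr0.
  by rewrite big_mkord; apply: eq_bigr => i _; rewrite /F -ltnS ltn_ord.
by move=> i /andP[/andP[pi _] _]; rewrite /F leqNgt pi mulr0.
Qed.

(* ord_oo, with ord_oo 0 = +oo. *)
Definition is_ord_inf (f : laurent) (v : int) : Prop :=
  f v != 0 /\ forall k, f k != 0 -> v <= k.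

Definition ord_inf (f : laurent) : \bar int :=
  match pselect (exists v, is_ord_inf f v) with
  | left ex => (projT1 (cid ex))%:E
  | right _ => +oo%E
  end.

Lemma ord_inf_geP (f : laurent) (N : int) :
  (N%:E <= ord_inf f)%E <-> forall k, k < N -> f k = 0.
Proof.
rewrite /ord_inf; case: pselect => [ex|nex].
  case: (cid ex) => v [fv vmin] /=; rewrite lee_fin; split=> [Nv k kN|h].
    by apply/eqP/negP => /negP /vmin /(le_trans Nv); rewrite leNgt kN.
  by rewrite leNgt; apply/negP => /h /eqP; rewrite (negPf fv).
rewrite leey; split=> // _ k _.
apply/eqP/negPn/negP => fk; apply: nex.
have /asboolP[M hM] := lcoefP f.
have ge_M j : f j != 0 -> M <= j.
  by move=> fj; rewrite leNgt; apply/negP => /hM /eqP; rewrite (negPf fj).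
have shiftK j : M <= j -> j = M + `|j - M|%N%:Z.
  by move=> ?; rewrite gez0_abs ?subr_ge0 // addrCA subrr addr0.
have ex : exists i : nat, f (M + i%:Z) != 0.
  by exists `|k - M|%N; rewrite -shiftK ?ge_M.
case: (ex_minnP ex) => i fi imin.
exists (M + i%:Z); split=> // j fj.
have Mj := ge_M j fj.
by rewrite (shiftK j Mj) lerD2l lez_nat imin // -shiftK.
Qed.

(* \sum_(k >= a) u_k = S for the 1/z-adic topology of K((1/z)). *)
Definition laurent_sum (a : nat) (u : nat -> laurent) (S : laurent) : Prop :=
  forall N : int, exists n0 : nat, forall n, (n0 <= n)%N ->
    (N%:E <= ord_inf (S - \sum_(a <= k < n) u k)%R)%E.

End Laurent.

Section PadeObjects.
Variable K : fieldType.

(* Weight (w_j)_(j : J) Pade-type approximants of (f_j)_(j : J). *)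
Definition pade_type_approx (J : Type) (w : J -> nat) (f : J -> laurent K)
    (P : {poly K}) (Q : J -> {poly K}) : Prop :=
  (P != 0 \/ exists j, Q j != 0) /\
  forall j, (((w j).+1%:Z)%:E <= ord_inf (P *: f j - lpoly (Q j))%R)%E.

(* The K-linear map K[t] -> K, t^k |-> f_k, for f = \sum_k f_k z^(-k-1). *)
Definition phi (f : laurent K) (P : {poly K}) : K :=
  \sum_(k < size P) P`_k * f k.+1%:Z.

(* The K[z]-linear extension of phi f to K[z][t] = {poly {poly K}}; the outer
   variable is t, the inner one z. *)
Definition phi_ext (f : laurent K) (F : {poly {poly K}}) : {poly K} :=
  \sum_(k < size F) f k.+1%:Z *: F`_k.

(* (P(z) - P(t)) / (z - t) in K[z][t]. The division is exact, and the leading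
   coefficient -1 of z - t is a unit, so %/ is the true quotient. *)
Definition divdiff (P : {poly K}) : {poly {poly K}} :=
  (P%:P - P^:P) %/ ('X%:P - 'X).

Lemma divdiffP P : divdiff P * ('X%:P - 'X) = P%:P - P^:P.
Proof.
have : root (P%:P - P^:P) 'X.
  by rewrite /root !hornerE [X in _ - X](_ : _ = P) ?subrr // -/(P \Po 'X) comp_polyXr.
rewrite /divdiff => /factor_theorem [q ->].
have -> : q * ('X - 'X%:P) = - q * ('X%:P - 'X) by rewrite mulNr -mulrN opprB.
rewrite Pdiv.IdomainUnit.mulpK //.
by rewrite -opprB lead_coefN lead_coefXsubC unitrN1.
Qed.

Definition invMellin (g : nat -> K) : laurent K :=
  let b k := k`!%:R * fps_comp g fps_expm1 k in
  lps 1 (fun k => (-1) ^+ k.+1 * b k).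

(* g_{i,s} for alpha_i = a; the case s = 0 is never used. *)
Definition gser (a : K) (s : nat) : nat -> K :=
  if s == 1%N then fps_divz (fun k => fps_pow1p a k - fps_one k)
  else fps_divz (fps_mul (fps_pow1p a) (fps_exp fps_log1p s.-1)).

Definition Rser (a : K) (s : nat) : laurent K := invMellin (gser a s).

(* The Pochhammer symbol (x)_n. *)
Definition poch (R : nzRingType) (x : R) (n : nat) : R :=
  \prod_(i < n) (x + i%:R).

Definition Delta_m1 (P : {poly K}) : {poly K} := P \Po ('X - 1) - P.

Variables (d : nat) (m : 'I_d -> nat) (alpha : 'I_d -> K).

(* The index set I, with i counted from 0: i : 'I_d stands for i + 1. *)
Definition inI (i : 'I_d) (s : nat) : bool :=
  (1 <= s <= (m i).+1)%N && ~~ ((i == 0%N :> nat) && (s == 1%N)).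

Definition Idx := {p : 'I_d * nat | inI p.1 p.2}.

Definition Apol (n l : nat) : {poly K} :=
  (-1) ^+ l * ((l`!%:R)^-1 *: poch 'X l) *
  \prod_(i < d) ((-1) ^+ n * ((n`!%:R)^-1 *: poch ('X + (alpha i)%:P) n))
                  ^+ (m i).+1.

Definition Ppol (n l : nat) : {poly K} := iter n Delta_m1 (Apol n l).

Definition Qpol (n : nat) (i : 'I_d) (s l : nat) : {poly K} :=
  phi_ext (Rser (alpha i) s) (divdiff (Ppol n l)).

(* p_{n,j,l}; the exponent n - k is a possibly negative integer. *)
Definition pcoef (n j l : nat) : K :=
  \sum_(n <= k < (j + n).+1)
     'C(j + n, k)%:R * (-1) ^ (n%:Z - k%:Z) * 'C(k, l)%:R *
     \prod_(r < d) gbinom (k%:R - alpha r) n ^+ (m r).+1.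

Definition remainder (n : nat) (i : 'I_d) (s l : nat) : laurent K :=
  Ppol n l *: Rser (alpha i) s - lpoly (Qpol n i s l).

End PadeObjects.

Notation "x %:F" := (tofrac x) : ring_scope.

(* Main.v *)
Require Import Defs.
From mathcomp Require Import all_boot all_order all_algebra.
From mathcomp Require Import boolp classical_sets functions constructive_ereal.
From mathcomp Require Import zify ring.

Import Order.TTheory GRing.Theory Num.Theory.
Local Open Scope ring_scope.

(* The map phi attached to R_(a,s) sends (t)_j to (-1)^(j+1) j! a_j, where
   g_(a,s) = \sum_j a_j z^j: the Stirling numbers that convert powers into
   rising factorials are the coefficients of (e^z - 1)^j. Since Delta_(-1) maps
   (t)_j to -j (t)_(j-1), the functional F |-> phi (Delta_(-1) F) is governed by
   the coefficients of z g_(a,s)(z), that is of (1+z)^a log^(s-1)(1+z), and it is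
   therefore, up to sign, evaluation of F^(s-1) at -a (minus F(0) when s = 1).
   A_(n,l) vanishes to order m_i + 1 at -alpha_i - r for r < n, so n summations
   by parts against (t)_k lose no boundary term: this kills
   phi ((t)_k P_(n,l)) for k < n and gives its value for k >= n.
   The remainder is phi (P(t) / (z - t)), and expanding
   1 / (z - t) = \sum_k (t)_k / (z)_(k+1) yields its series. *)

(** * Rising factorials and the Newton basis *)

Section Poch.
Variable R : nzRingType.
Implicit Type x : R.

Lemma poch0 x : poch x 0 = 1.
Proof. by rewrite /poch big_ord0. Qed.

Lemma pochS x n : poch x n.+1 = poch x n * (x + n%:R).
Proof. by rewrite /poch big_ord_recr. Qed.

Lemma pochSl x n : poch x n.+1 = x * poch (x + 1) n.
Proof.
rewrite /poch big_ord_recl addr0; congr (_ * _); apply: eq_bigr => i _.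
by rewrite /bump /= natrD addrA.
Qed.

End Poch.

Section PochPoly.
Variable K : fieldType.
Implicit Types (a x : K) (p q : {poly K}).

Lemma poch_comp p q n : poch p n \Po q = poch (p \Po q) n.
Proof.
rewrite /poch rmorph_prod /=; apply: eq_bigr => i _.
by rewrite rmorphD rmorph_nat.
Qed.

Lemma horner_poch p n x : (poch p n).[x] = poch p.[x] n.
Proof.
rewrite /poch horner_prod; apply: eq_bigr => i _.
by rewrite hornerD -polyC_natr hornerC.
Qed.

Lemma poch_linear a n :
  poch ('X + a%:P) n = \prod_(i < n) ('X - (- (a + i%:R))%:P).
Proof.
by apply: eq_bigr => i _; rewrite polyCN opprK polyCD polyC_natr addrA.
Qed.

Lemma poch_monic a n : poch ('X + a%:P) n \is monic.
Proof. by rewrite poch_linear; apply: monic_prod => i _; exact: monicXsubC. Qed.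

Lemma size_poch a n : size (poch ('X + a%:P) n) = n.+1.
Proof.
by rewrite poch_linear size_prod_XsubC /index_enum -enumT size_enum_ord.
Qed.

Lemma pochX_neq0 n : poch 'X n != 0 :> {poly K}.
Proof. by rewrite -['X]addr0; exact: monic_neq0 (poch_monic 0 n). Qed.

Lemma size_pochX n : size (poch 'X n : {poly K}) = n.+1.
Proof. by rewrite -['X]addr0; exact: size_poch 0 n. Qed.

Lemma Delta_m1D : {morph @Delta_m1 K : p q / p + q}.
Proof. by move=> p q; rewrite /Delta_m1 comp_polyD; ring. Qed.

Lemma Delta_m1Z a : {morph @Delta_m1 K : p / a *: p}.
Proof. by move=> p; rewrite /Delta_m1 comp_polyZ scalerBr. Qed.

Lemma Delta_m1_0 : Delta_m1 (0 : {poly K}) = 0.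
Proof. by rewrite /Delta_m1 comp_poly0 subr0. Qed.

Lemma Delta_poch n :
  Delta_m1 (poch 'X n : {poly K}) = - (n%:R * poch 'X n.-1).
Proof.
case: n => [|n].
  by rewrite /Delta_m1 !poch0 comp_polyC subrr mul0r oppr0.
rewrite /Delta_m1 poch_comp comp_polyX pochSl subrK pochS /=.
by rewrite -natr1; ring.
Qed.

(** [Delta_m1] is a shift minus the identity, so this is the binomial expansion of its power; the
    induction step is Pascal's rule. *)
Lemma iter_Delta_m1E n p :
  iter n (@Delta_m1 K) p =
  \sum_(k < n.+1) ('C(n, k)%:R * (-1) ^+ (n - k)) *: (p \Po ('X - k%:R)).
Proof.
elim: n => [|n IH].
  by rewrite big_ord1 bin0 subnn expr0 mulr1 scale1r subr0 comp_polyXr.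
have shift k : p \Po ('X - k%:R) \Po ('X - 1) = p \Po ('X - k.+1%:R).
  rewrite -comp_polyA; congr (_ \Po _).
  by rewrite comp_polyB comp_polyX -polyC_natr comp_polyC polyC_natr -natr1; ring.
rewrite iterS IH /Delta_m1 linear_sum /=.
under eq_bigr => k _ do rewrite comp_polyZ shift.
rewrite [in RHS]big_ord_recl [X in _ - X]big_ord_recl /=.
under [in RHS]eq_bigr => k _ do
  rewrite /bump /= add1n binS natrD mulrDl scalerDl subSS.
rewrite big_split /= [in RHS]big_ord_recr /= (bin_small (ltnSn n)) mul0r scale0r addr0.
rewrite !bin0 !subn0 !mul1r exprS mulN1r scaleNr opprD -sumrN.
rewrite [X in _ + (_ + X)](eq_bigr (fun i : 'I_n =>
   ('C(n, i.+1)%:R * (-1) ^+ (n - i)) *: (p \Po ('X - i.+1%:R)))).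
  by rewrite addrCA; congr (_ + _); exact: addrC.
move=> i _; rewrite /bump /= add1n -scaleNr; congr (_ *: _).
by rewrite -[in RHS](subnSK (ltn_ord i)) exprS; ring.
Qed.

End PochPoly.

Section NewtonBasis.
Variable K : fieldType.
Hypothesis charK0 : [pchar K] =i pred0.
Implicit Types (a x : K) (p q : {poly K}).

Lemma natSr_neq0 n : n.+1%:R != 0 :> K.
Proof. by move/pcharf0P: charK0 => ->. Qed.

Lemma factr_neq0 n : n`!%:R != 0 :> K.
Proof. by rewrite -(prednK (fact_gt0 n)) natSr_neq0. Qed.

(** With this normalisation [Delta_m1] is a negated index shift, so coefficients in this basis are
    read off by iterating it and evaluating at 0. *)
Definition rbin (j : nat) : {poly K} := (j`!%:R)^-1 *: poch 'X j.

Lemma rbin0 : rbin 0 = 1.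
Proof. by rewrite /rbin poch0 invr1 scale1r. Qed.

Lemma pochX_rbin j : poch 'X j = j`!%:R *: rbin j.
Proof. by rewrite /rbin scalerA divff ?factr_neq0 // scale1r. Qed.

Lemma rbinMX j : rbin j * 'X = j.+1%:R *: rbin j.+1 - j%:R *: rbin j.
Proof.
have -> : j.+1%:R *: rbin j.+1 = rbin j * ('X + j%:R).
  rewrite /rbin pochS scalerA factS natrM invfM mulrA divff ?natSr_neq0 //.
  by rewrite mul1r scalerAl.
by rewrite mulrDr mulr_natr scaler_nat addrK.
Qed.

Lemma Delta_rbin j : Delta_m1 (rbin j) = if j is i.+1 then - rbin i else 0.
Proof.
rewrite /rbin Delta_m1Z Delta_poch; case: j => [|j].
  by rewrite mul0r oppr0 scaler0.
rewrite scalerN -scaler_nat scaler_nat mulr_natl -scaler_nat scalerA.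
by rewrite factS natrM invfM mulrAC mulVf ?natSr_neq0 // mul1r.
Qed.

Lemma horner0_rbin j : (rbin j).[0] = (j == 0%N)%:R.
Proof.
case: j => [|j]; first by rewrite rbin0 hornerC.
by rewrite /rbin pochSl hornerZ hornerM hornerX mul0r mulr0.
Qed.

Lemma newton_exists N p : (size p <= N)%N ->
  exists c : nat -> K, p = \sum_(j < N) c j *: rbin j.
Proof.
elim: N p => [|N IH] p.
  rewrite leqn0 size_poly_eq0 => /eqP->.
  by exists (fun=> 0); rewrite big_ord0.
move=> sp; have sq : (size (p - p`_N *: poch 'X N)%R <= N)%N.
  apply/leq_sizeP => j; rewrite leq_eqVlt => /orP[/eqP <-|ltNj].
    have /monicP := poch_monic K 0 N; rewrite polyC0 addr0 lead_coefE size_pochX /=.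
    by rewrite coefB coefZ => ->; rewrite mulr1 subrr.
  rewrite coefB coefZ.
  have /leq_sizeP/(_ j ltNj) -> : (size (poch 'X N : {poly K}) <= N.+1)%N.
    by rewrite size_pochX.
  by rewrite mulr0 subr0 (leq_sizeP _ _ sp).
have [c hc] := IH _ sq.
(* The factorial appears because the monic [poch 'X N], used to remove the leading term, is N! times
   [rbin N]. *)
exists (fun j => if j == N then p`_N * N`!%:R else c j).
rewrite big_ord_recr /= eqxx -scalerA -pochX_rbin -[LHS](subrK (p`_N *: poch 'X N)).
congr (_ + _); rewrite hc; apply: eq_bigr => j _; rewrite ifN //.
by rewrite neq_ltn ltn_ord.
Qed.

Lemma iter_Delta_newton k N (c : nat -> K) :
  iter k (@Delta_m1 K) (\sum_(j < N) c j *: rbin j) =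
  (-1) ^+ k *: \sum_(j < N - k) c (j + k)%N *: rbin j.
Proof.
elim: k => [|k IH].
  by rewrite subn0 scale1r; apply: eq_bigr => j _; rewrite addn0.
rewrite iterS IH Delta_m1Z exprS mulN1r scaleNr -scalerN subnS; congr (_ *: _).
rewrite (big_morph _ (@Delta_m1D K) (@Delta_m1_0 K)) -sumrN.
under eq_bigr => j _ do rewrite Delta_m1Z Delta_rbin.
case: (N - k)%N => [|N']; first by rewrite !big_ord0.
rewrite big_ord_recl scaler0 add0r; apply: eq_bigr => j _.
by rewrite lift0 addSnnS scalerN.
Qed.

Lemma newton_coef N (c : nat -> K) k : (k < N)%N ->
  c k = (-1) ^+ k * (iter k (@Delta_m1 K) (\sum_(j < N) c j *: rbin j)).[0].
Proof.
move=> kN; rewrite iter_Delta_newton hornerZ mulrA -exprMn mulrNN mulr1 expr1n mul1r.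
(* Only the basis element of index 0 is nonzero at 0; [k < N] makes the sum nonempty. *)
rewrite horner_sum -[(N - k)%N]prednK ?subn_gt0 // big_ord_recl.
rewrite hornerZ horner0_rbin mulr1 add0n big1 ?addr0 // => i _.
by rewrite hornerZ horner0_rbin mulr0.
Qed.

End NewtonBasis.

(** * Formal power series and the functional phi *)

Section PhiLinear.
Variables (K : fieldType) (f : laurent K).
Implicit Types p q : {poly K}.

Lemma phiE N p : (size p <= N)%N -> phi f p = \sum_(k < N) p`_k * f k.+1%:Z.
Proof.
move=> sp; rewrite /phi (big_ord_widen _ (fun k => p`_k * f k.+1%:Z) sp).
rewrite big_mkcond; apply: eq_bigr => k _; case: ltnP => // sk.
by rewrite nth_default // mul0r.
Qed.

Lemma phiD : {morph phi f : p q / p + q}.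
Proof.
move=> p q; set N := maxn (size p) (size q).
rewrite !(@phiE N) ?leq_maxl ?leq_maxr ?size_polyD // -big_split /=.
by apply: eq_bigr => k _; rewrite coefD mulrDl.
Qed.

Lemma phiZ a : {morph phi f : p / a *: p >-> a * p}.
Proof.
move=> p; rewrite (@phiE (size p)) ?size_scale_leq // /phi big_distrr /=.
by apply: eq_bigr => k _; rewrite coefZ mulrA.
Qed.

Lemma phi0 : phi f 0 = 0.
Proof. by rewrite /phi size_poly0 big_ord0. Qed.

Lemma phi_sum I (r : seq I) (P : pred I) (F : I -> {poly K}) :
  phi f (\sum_(i <- r | P i) F i) = \sum_(i <- r | P i) phi f (F i).
Proof. exact: (big_morph _ phiD phi0). Qed.

Lemma phiN : {morph phi f : p / - p}.
Proof. by move=> p; rewrite -scaleN1r phiZ mulN1r. Qed.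

Lemma phiXn k : phi f 'X^k = f k.+1%:Z.
Proof.
rewrite (@phiE k.+1) ?size_polyXn // big_ord_recr /= coefXn eqxx mul1r.
by rewrite big1 ?add0r // => i _; rewrite coefXn ltn_eqF ?ltn_ord // mul0r.
Qed.

End PhiLinear.

Section FpsPoly.
Variable K : fieldType.
Implicit Types f g h : nat -> K.

(** Low-order coefficients depend only on truncations, which lets identities be imported from the
    polynomial ring. *)
Lemma coef_fps_mul N f g k : (k < N)%N ->
  fps_mul f g k = (\poly_(i < N) f i * \poly_(i < N) g i)`_k.
Proof.
move=> kN; rewrite coefM; apply: eq_bigr => i _; rewrite !coef_poly.
by rewrite !(leq_ltn_trans _ kN) ?leq_subr // -ltnS.
Qed.

Lemma coef_fps_exp N f i k : (k < N)%N ->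
  fps_exp f i k = ((\poly_(j < N) f j) ^+ i)`_k.
Proof.
elim: i k => [|i IH] k kN; first by rewrite expr0 coef1.
rewrite exprS coefM -[LHS]/(fps_mul f (fps_exp f i) k); apply: eq_bigr => j _.
have jN : (j < N)%N by apply: leq_ltn_trans kN; rewrite -ltnS.
by rewrite coef_poly jN IH // (leq_ltn_trans (leq_subr j k)).
Qed.

Lemma fps_mulA f g h : fps_mul f (fps_mul g h) =1 fps_mul (fps_mul f g) h.
Proof.
move=> k; rewrite !(@coef_fps_mul k.+1) //.
(* Truncating a product and multiplying truncations may differ beyond degree k, but only degrees up
   to k enter. *)
have low (u v : nat -> K) j : (j < k.+1)%N ->
    (\poly_(i < k.+1) fps_mul u v i)`_j
    = (\poly_(i < k.+1) u i * \poly_(i < k.+1) v i)`_j.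
  by move=> jk; rewrite coef_poly jk (@coef_fps_mul k.+1).
transitivity (\poly_(i < k.+1) f i * (\poly_(i < k.+1) g i * \poly_(i < k.+1) h i))`_k.
  rewrite !(coefM (\poly_(i < k.+1) f i)); apply: eq_bigr => i _.
  by rewrite low // ltnS leq_subr.
rewrite mulrA !(coefMr _ (\poly_(i < k.+1) h i)).
by apply: eq_bigr => i _; rewrite low // ltnS leq_subr.
Qed.

Lemma fps_mulC f g : fps_mul f g =1 fps_mul g f.
Proof. by move=> k; rewrite !(@coef_fps_mul k.+1) // mulrC. Qed.

Lemma fps_mulr1 f : fps_mul f fps_one =1 f.
Proof.
move=> k; rewrite /fps_mul big_ord_recr /= subnn mulr1 big1 ?add0r // => i _.
by rewrite /fps_one subn_eq0 leqNgt ltn_ord mulr0.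
Qed.

End FpsPoly.

(** * Stirling numbers and the values of [phi] on rising factorials *)

Section Stirling.
Variable K : fieldType.
Hypothesis charK0 : [pchar K] =i pred0.

(* (e^z - 1)^(i+1) has derivative (i + 1) ((e^z - 1)^(i+1) + (e^z - 1)^i). *)
Lemma fps_exp_expm1_rec i k :
  k.+1%:R * fps_exp fps_expm1 i.+1 k.+1 =
  i.+1%:R * (fps_exp fps_expm1 i.+1 k + fps_exp fps_expm1 i k) :> K.
Proof.
rewrite !(@coef_fps_exp _ k.+2) //; set E := \poly_(j < k.+2) _.
rewrite mulr_natl -coef_deriv deriv_exp /= coefMn -[LHS]mulr_natl; congr (_ * _).
rewrite -coefD exprS -{3}(mul1r (E ^+ i)) -mulrDl !coefM.
apply: eq_bigr => j _; congr (_ * _).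
have jk : (j < k.+2)%N by rewrite ltnW // ltnS.
(* In these degrees the derivative of E is E + 1; the 1 supplies the constant term that e^z - 1
   lacks. *)
rewrite coef_deriv coefD coef1 !coef_poly ltnS ltn_ord jk /fps_expm1 /=.
have -> : (j.+1)`!%:R^-1 *+ j.+1 = j`!%:R^-1 :> K.
  by rewrite -[LHS]mulr_natl factS natrM invfM mulrA mulfV ?natSr_neq0 ?mul1r.
by case: (j : nat) => [|i']; rewrite ?add0r ?addr0 ?invr1.
Qed.

(** The number k! [z^k] (e^z - 1)^i is i! times a Stirling number of the second kind. Up to sign,
    its recurrence is the one that [rbinMX] gives for multiplication by X. *)
Lemma expX_rbin k :
  'X^k = \sum_(i < k.+1)
    ((-1) ^+ (k + i) * k`!%:R * fps_exp fps_expm1 i k) *: rbin K i.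
Proof.
pose s k i : K := (-1) ^+ (k + i) * k`!%:R * fps_exp fps_expm1 i k.
have sSS j i : s j.+1 i.+1 = i.+1%:R * (s j i - s j i.+1).
  rewrite /s factS natrM addSn addnS !exprS.
  have := fps_exp_expm1_rec i j; set u := fps_exp _ _ _ => H.
  transitivity ((-1) ^+ (j + i) * j`!%:R * (j.+1%:R * u)); first by ring.
  by rewrite H; ring.
have sS0 j : s j.+1 0%N = 0 by rewrite /s /= /fps_one mulr0.
have s_big j : s j j.+1 = 0 by rewrite /s fps_exp_eq0 ?mulr0.
have s00 : s 0%N 0%N = 1 by rewrite /s /= /fps_one !mulr1.
rewrite -[RHS]/(\sum_(i < k.+1) s k i *: rbin K i); clearbody s.
elim: k => [|k IH]; first by rewrite big_ord1 rbin0 s00 scale1r expr0.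
rewrite exprSr IH big_distrl [in RHS]big_ord_recl sS0 scale0r add0r /=.
transitivity (\sum_(i < k.+1) (s k i * i.+1%:R) *: rbin K i.+1
              - \sum_(i < k.+2) (s k i * i%:R) *: rbin K i).
  rewrite [X in _ - X]big_ord_recr /= s_big mul0r scale0r addr0 -sumrB.
  apply: eq_bigr => i _; rewrite -scalerAl rbinMX // scalerBr.
  by rewrite (scalerA _ i.+1%:R) (scalerA _ i%:R).
rewrite [X in _ - X]big_ord_recl mulr0 scale0r add0r -sumrB.
apply: eq_bigr => i _; rewrite lift0 -scalerBl sSS; congr (_ *: _); ring.
Qed.

Lemma fps_exp_expm1_diag i : fps_exp fps_expm1 i i = 1 :> K.
Proof.
elim: i => [//|i IH]; have := fps_exp_expm1_rec i i.
by rewrite (@fps_exp_eq0 _ _ i.+1 i) // add0r IH => /(mulfI (natSr_neq0 _ charK0 i)).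
Qed.

Lemma invMellin_coef (g : nat -> K) k :
  invMellin g k.+1%:Z = (-1) ^+ k.+1 * (k`!%:R * fps_comp g fps_expm1 k).
Proof. by rewrite /= subn1. Qed.

(* [k! [z^k] g(e^z - 1)] expands in Stirling numbers exactly as [X^k] does. *)
Lemma phi_invMellin_rbin (g : nat -> K) j :
  phi (invMellin g) (rbin K j) = (-1) ^+ j.+1 * g j.
Proof.
elim/ltn_ind: j => j IH.
have := phiXn _ (invMellin g) j; rewrite invMellin_coef expX_rbin phi_sum /fps_comp.
rewrite !big_ord_recr /= phiZ fps_exp_expm1_diag !mulr1 mulrA mulrDr.
(* By induction the terms of index below j agree on both sides; the terms of index j are then
   compared after cancelling j!. *)
have -> : \sum_(i < j) phi (invMellin g)
     (((-1) ^+ (j + i) * j`!%:R * fps_exp fps_expm1 i j) *: rbin K i) =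
   (-1) ^+ j.+1 * j`!%:R * \sum_(i < j) g i * fps_exp fps_expm1 i j.
  rewrite big_distrr /=; apply: eq_bigr => i _; rewrite phiZ IH //.
  rewrite -[RHS]mul1r -[X in X * (_ * _)](sqrr_sign K i) exprD !exprS; ring.
move/addrI; rewrite addnn -muln2 exprM sqrr_sign.
by rewrite mul1r mulrAC [in RHS]mulrC; exact/mulfI/(factr_neq0 _ charK0).
Qed.

(** The division by z cancels the index shift of [Delta_m1]; [h 0 = 0] accounts for j = 0, where
    [Delta_m1] gives zero. *)
Lemma phi_invMellin_Delta_rbin (h : nat -> K) j : h 0%N = 0 ->
  phi (invMellin (fps_divz h)) (Delta_m1 (rbin K j)) = (-1) ^+ j.+1 * h j.
Proof.
move=> h0; rewrite Delta_rbin //; case: j => [|j]; first by rewrite phi0 h0 mulr0.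
by rewrite phiN phi_invMellin_rbin [in RHS]exprS mulN1r mulNr.
Qed.

(** Behind this is the generating series (1 - z)^(-x) of the [rbin] at x: differentiating in x
    multiplies it by -log(1 - z), the sum of z^r / r over r >= 1. The proof is an induction through
    [rbinMX]. *)
Lemma deriv_rbin j :
  (rbin K j)^`() = \sum_(i < j) (j - i)%:R^-1 *: rbin K i.
Proof.
elim: j => [|j IH]; first by rewrite rbin0 derivC big_ord0.
have natB_neq0 k i : (i < k)%N -> (k - i)%:R != 0 :> K.
  by move=> ik; rewrite -(subnSK ik) natSr_neq0.
apply: (scalerI (natSr_neq0 _ charK0 j)).
have -> : j.+1%:R *: (rbin K j.+1)^`() = (rbin K j * 'X + j%:R *: rbin K j)^`().
  by rewrite -derivZ rbinMX // subrK.
rewrite derivD derivM derivX mulr1 derivZ IH.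
transitivity (\sum_(i < j) (i.+1%:R / (j - i)%:R) *: rbin K i.+1
              + \sum_(i < j.+1) rbin K i).
  rewrite addrAC [in RHS]big_ord_recr addrA; congr (_ + _).
  rewrite big_distrl scaler_sumr -!big_split /=; apply: eq_bigr => i _.
  rewrite -scalerAl rbinMX // scalerBr (scalerA _ i.+1%:R) (scalerA _ i%:R).
  rewrite (scalerA j%:R) [_ / _]mulrC -addrA; congr (_ + _).
  rewrite addrC -scalerBl mulrC -mulrBr -natrB 1?ltnW //.
  by rewrite mulVf ?scale1r // natB_neq0.
have -> : \sum_(i < j) (i.+1%:R / (j - i)%:R) *: rbin K i.+1 =
          \sum_(i < j.+1) (i%:R / (j.+1 - i)%:R) *: rbin K i.
  by rewrite big_ord_recl mul0r scale0r add0r.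
rewrite scaler_sumr -big_split /=; apply: eq_bigr => i _.
rewrite (scalerA j.+1%:R) -[X in _ + X]scale1r -scalerDl; congr (_ *: _).
have ne0 := natB_neq0 _ _ (ltn_ord i).
(* The coefficients combine as i/(j+1-i) + 1 = (j+1)/(j+1-i). *)
have -> : j.+1%:R = i%:R + (j.+1 - i)%:R :> K by rewrite -natrD subnKC // ltnW.
by rewrite mulrDl divff.
Qed.

(** Differentiating (1 - z)^(-x) s times in x and putting x = -a gives (1 - z)^a (-log(1 - z))^s;
    replacing z by -z produces the sign. *)
Lemma horner_derivn_rbin (a : K) s j :
  (rbin K j)^`(s).[- a] =
  (-1) ^+ (j + s) * fps_mul (fps_pow1p a) (fps_exp fps_log1p s) j.
Proof.
elim: s j => [|s IH] j.
  rewrite addn0 fps_mulr1 /rbin derivn0 hornerZ horner_poch hornerX mulrC.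
  rewrite /fps_pow1p /gbinom mulrA; congr (_ / _).
  rewrite -[X in _ ^+ X](card_ord j) -prodr_const -big_split /=.
  by apply: eq_bigr => i _; rewrite mulN1r opprB addrC.
rewrite /derivn iterSr -/(derivn s _) deriv_rbin linear_sum horner_sum.
under eq_bigr => i _ do rewrite linearZ hornerZ IH.
have -> : fps_mul (fps_pow1p a) (fps_exp fps_log1p s.+1) j =
  \sum_(i < j.+1) fps_mul (fps_pow1p a) (fps_exp fps_log1p s) i * fps_log1p (j - i)%N.
  transitivity
    (fps_mul (fps_mul (fps_pow1p a) (fps_exp fps_log1p s)) fps_log1p j) => //.
  rewrite -fps_mulA; apply: eq_bigr => i _; congr (_ * _); exact: fps_mulC.
(* The logarithm has no constant term, so the top term drops and the range matches that of
   [deriv_rbin]. *)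
rewrite big_ord_recr /= subnn mulr0 addr0 big_distrr /=.
apply: eq_bigr => i _; rewrite -(subnSK (ltn_ord i)) /=; set r := (j - i.+1)%N.
have -> : (j + s.+1 = i + r.+1 + s.+1)%N by rewrite /r; have := ltn_ord i; lia.
rewrite -[LHS]mul1r -[X in X * (_ * _)](sqrr_sign K r) !exprD !exprS.
by ring.
Qed.

End Stirling.

(** * Summation by parts *)

Section Vanishing.
Variable K : fieldType.
Implicit Types p q : {poly K}.

Lemma dvdp_XsubC_deriv (a : K) r p :
  ('X - a%:P) ^+ r.+1 %| p -> ('X - a%:P) ^+ r %| p^`().
Proof.
case/dvdpP => q ->; rewrite derivM deriv_exp derivXsubC mul1r exprS.
rewrite -mulr_natl; apply: dvdp_add; first by rewrite mulrA dvdp_mulIr.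
by rewrite mulrA dvdp_mulIr.
Qed.

Lemma horner_derivn_eq0 (a : K) r s p :
  ('X - a%:P) ^+ r %| p -> (s < r)%N -> p^`(s).[a] = 0.
Proof.
elim: s r p => [|s IH] [|r] p // dp sr.
  by apply/rootP; rewrite -dvdp_XsubCl; apply: dvdp_trans dp; rewrite exprS dvdp_mulIl.
by rewrite /derivn iterSr -/(derivn s _); apply: (IH r) => //; exact: dvdp_XsubC_deriv.
Qed.

Hypothesis charK0 : [pchar K] =i pred0.

Lemma poly_rbin_ind (u v : {poly K} -> K) :
  {morph u : p q / p + q} -> {morph v : p q / p + q} ->
  (forall a, {morph u : p / a *: p >-> a * p}) ->
  (forall a, {morph v : p / a *: p >-> a * p}) ->
  (forall j, u (rbin K j) = v (rbin K j)) -> u =1 v.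
Proof.
move=> uD vD uZ vZ uv p.
have [c ->] := newton_exists _ charK0 _ _ (leqnn (size p)).
have u0 : u 0 = 0 by rewrite -(scale0r 0) uZ mul0r.
have v0 : v 0 = 0 by rewrite -(scale0r 0) vZ mul0r.
rewrite (big_morph _ uD u0) (big_morph _ vD v0).
by apply: eq_bigr => j _; rewrite uZ vZ uv.
Qed.

(** On [rbin K j] both sides are, up to sign, the j-th coefficient of (1+z)^a log^(s-1)(1+z). *)
Lemma phi_Rser_Delta (a : K) s p : (1 < s)%N ->
  phi (Rser a s) (Delta_m1 p) = (-1) ^+ s * p^`(s.-1).[- a].
Proof.
case: s => [//|[//|s] _]; apply: (poly_rbin_ind (fun p => phi _ (Delta_m1 p))
    (fun p => (-1) ^+ s.+2 * p^`(s.+1).[- a])) => [q r|q r|b q|b q|j].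
- by rewrite Delta_m1D phiD.
- by rewrite derivnD hornerD mulrDr.
- by rewrite Delta_m1Z phiZ.
- by rewrite derivnZ hornerZ mulrCA.
rewrite horner_derivn_rbin // /Rser /gser /= phi_invMellin_Delta_rbin //.
  by rewrite mulrA -exprD -(signr_odd _ (s.+2 + _)) -(signr_odd _ j.+1);
     congr (_ ^+ nat_of_bool _ * _); lia.
(* At least one logarithm is present since s > 1, so the constant term is zero. *)
by rewrite /fps_mul !big_ord1 /= mul0r mulr0.
Qed.

(** The constant 1 subtracted in the numerator of g_(i,1) is what contributes the value at 0. *)
Lemma phi_Rser1_Delta (a : K) p :
  phi (Rser a 1) (Delta_m1 p) = p.[0] - p.[- a].
Proof.
apply: (poly_rbin_ind (fun p => phi _ (Delta_m1 p))
    (fun p => p.[0] - p.[- a])) => [q r|q r|b q|b q|j].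
- by rewrite Delta_m1D phiD.
- by rewrite !hornerD; ring.
- by rewrite Delta_m1Z phiZ.
- by rewrite !hornerZ mulrBr.
rewrite /Rser /gser /= phi_invMellin_Delta_rbin //.
  rewrite horner0_rbin -[rbin K j]derivn0 horner_derivn_rbin // addn0 fps_mulr1.
  by rewrite mulrBr exprS /fps_one; case: j => [|j] /=; ring.
by rewrite /fps_pow1p /gbinom /fps_one big_ord0 divr1 subrr.
Qed.

End Vanishing.

Section SummationByParts.
Variable K : fieldType.
Hypothesis charK0 : [pchar K] =i pred0.
Variables (d : nat) (m : 'I_d -> nat) (alpha : 'I_d -> K).
Implicit Types p q : {poly K}.

(** Zeros of order at least m_i + 1 at -alpha_i - c; r counts the layers of zeros, and each use of
    [Delta_m1] consumes one. *)
Definition vanishes (r : nat) p : Prop := forall (i : 'I_d) (c : nat), (c < r)%N ->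
  ('X + (alpha i + c%:R)%:P) ^+ (m i).+1 %| p.

Lemma vanishes_mull r p q : vanishes r p -> vanishes r (q * p).
Proof. by move=> vp i c cr; rewrite dvdp_mull // vp. Qed.

(** A zero of p at -alpha_i - c - 1 becomes a zero of p(z - 1) at -alpha_i - c. *)
Lemma vanishes_Delta r p : vanishes r.+1 p -> vanishes r (Delta_m1 p).
Proof.
move=> vp i c cr; rewrite /Delta_m1 dvdp_sub ?vp //; last exact: leqW.
have := dvdp_comp_poly ('X - 1) (vp i c.+1 cr).
rewrite rmorphXn /= comp_polyD comp_polyX comp_polyC -natr1.
by rewrite addrA !polyCD [(alpha i)%:P + _ + _]addrC addrA subrK.
Qed.

Lemma vanishes_iter_Delta r k p :
  vanishes (r + k) p -> vanishes r (iter k (@Delta_m1 K) p).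
Proof.
elim: k r => [|k IH] r; first by rewrite addn0.
by rewrite addnS -addSn => /IH /vanishes_Delta.
Qed.

(** The functional evaluates a derivative of order s - 1 <= m_i at a zero of order m_i + 1. For s =
    1 the extra value p(0) vanishes because alpha_1 = 0. *)
Lemma phi_Delta_eq0 (d_gt0 : (0 < d)%N) (alpha1 : alpha (Ordinal d_gt0) = 0) i s p :
  inI m i s -> vanishes 1 p -> phi (Rser (alpha i) s) (Delta_m1 p) = 0.
Proof.
case/andP => /andP[s1 sm] is1 vp.
have vp_at j t : (t < (m j).+1)%N -> p^`(t).[- alpha j] = 0.
  apply: horner_derivn_eq0; rewrite polyCN opprK.
  by have := vp j 0%N isT; rewrite addr0.
case: (ltnP 1 s) => [s2|s_le1].
  rewrite phi_Rser_Delta // vp_at ?mulr0 //; lia.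
have -> : s = 1%N by lia.
rewrite phi_Rser1_Delta //.
have := vp_at (Ordinal d_gt0) 0%N isT; rewrite alpha1 oppr0 derivn0 => ->.
by have := vp_at i 0%N isT; rewrite derivn0 => ->; rewrite subrr.
Qed.

(* [f(t) Delta C = Delta (f(t+1) C) + (f(t+1) - f(t)) C], and
   [f(t+1) - f(t) = k (t+c+1)_(k-1)] for [f = (t+c)_k]. *)
Lemma poch_mul_Delta c k p :
  poch ('X + c%:R) k * Delta_m1 p =
  Delta_m1 (poch ('X + c.+1%:R) k * p) + k%:R *: (poch ('X + c.+1%:R) k.-1 * p).
Proof.
have comp_nat e (q : {poly K}) : e%:R \Po q = e%:R.
  by rewrite -polyC_natr comp_polyC.
rewrite /Delta_m1 comp_polyM poch_comp comp_polyD comp_polyX comp_nat.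
have -> : 'X - 1 + c.+1%:R = 'X + c%:R :> {poly K} by rewrite -natr1; ring.
case: k => [|k]; first by rewrite !poch0 scale0r; ring.
have -> : poch ('X + c.+1%:R) k.+1 =
    poch ('X + c%:R) k.+1 + k.+1%:R * poch ('X + c.+1%:R) k :> {poly K}.
  rewrite [in RHS]pochSl (_ : 'X + c%:R + 1 = 'X + c.+1%:R) ?pochS -?natr1 ?addrA //.
  by ring.
by rewrite scaler_nat -[_ *+ k.+1]mulr_natl; ring.
Qed.

(** Each summation by parts raises c, lowers k and yields a factor k, whence the falling factorial.
    The shift c is general for the sake of the induction. *)
Lemma phi_poch_iter_Delta (d_gt0 : (0 < d)%N) (alpha1 : alpha (Ordinal d_gt0) = 0) i s :
  inI m i s -> forall n c k p, vanishes n p ->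
  phi (Rser (alpha i) s) (poch ('X + c%:R) k * iter n (@Delta_m1 K) p) =
  (k ^_ n)%:R * phi (Rser (alpha i) s) (poch ('X + (c + n)%:R) (k - n) * p).
Proof.
move=> is_; elim=> [|n IH] c k p vp.
  by rewrite addn0 subn0 ffactn0 mul1r.
have vp1 : vanishes 1 (iter n (@Delta_m1 K) p) by exact: vanishes_iter_Delta.
(* The boundary term vanishes: after n differences one layer of zeros is left. *)
rewrite iterS poch_mul_Delta phiD phi_Delta_eq0 //; last exact: vanishes_mull.
rewrite add0r phiZ IH; last by move=> j e en; apply: vp; exact: leqW.
rewrite mulrA -natrM -ffactnS addSnnS; congr (_ * phi _ (poch _ _ * _)); lia.
Qed.

End SummationByParts.

(** * Remainders in K((1/z)) *)

Section LaurentLemmas.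
Variable K : fieldType.
Implicit Types (p q D : {poly K}) (f g : laurent K).

Lemma lcoef_polyCZ (a : K) f k : (a%:P *: f) k = a * f k.
Proof. exact: lscaleC. Qed.

Lemma lcoef_XZ f k : ('X *: f) k = f (k + 1).
Proof. by rewrite -['X]mul1r -[LHS]/(lscale_coef _ _ _) lscaleMX lscaleC mul1r. Qed.

Lemma lpolyD : {morph @lpoly K : p q / p + q}.
Proof.
move=> p q; apply/laurent_eqP => -[[|k]|k];
  by rewrite lcoefD /= ?coefD ?addr0.
Qed.

Lemma lpoly0 : lpoly (0 : {poly K}) = 0.
Proof. by apply/laurent_eqP => -[[|k]|k] /=; rewrite ?coef0. Qed.

Lemma lpolyXM q : 'X *: lpoly q = lpoly ('X * q).
Proof.
apply/laurent_eqP => -[k|[|k]]; rewrite lcoef_XZ.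
- by rewrite -PoszD addn1 /=; case: k => // ; rewrite coefXM.
- by rewrite /= coefXM.
by rewrite (_ : Negz k.+1 + 1 = Negz k) /= ?coefXM //; lia.
Qed.

Lemma lpolyCM (a : K) q : a%:P *: lpoly q = lpoly (a%:P * q).
Proof.
apply/laurent_eqP => k; rewrite lcoef_polyCZ.
by case: k => [[|k]|k] /=; rewrite ?mulr0 ?coefCM.
Qed.

(* Multiplication by [D] lowers the order at infinity by [deg D]. *)
Lemma lcoef_eq0_scale D f (v : int) : D != 0 ->
  (forall k, k < v -> (D *: f) k = 0) ->
  forall k, k < v + (size D).-1%:Z -> f k = 0.
Proof.
move=> D0 Dv; have [N hN] := asboolW (lcoefP f).
have sD : size D = (size D).-1.+1 by rewrite prednK // lt0n size_poly_eq0.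
suff H i : N + i%:Z < v + (size D).-1%:Z -> f (N + i%:Z) = 0.
  move=> k kv; case: (ltP k N) => [/hN //|Nk].
  have e : k = N + `|k - N|%N%:Z by lia.
  by rewrite e H // -e.
elim/ltn_ind: i => i IH iv.
(* This coefficient of D f is lead(D) f(N + i) plus multiples of earlier coefficients of f, all zero
   by induction or by the choice of N. *)
have := Dv (N + i%:Z - (size D).-1%:Z); rewrite ltrBlDr => /(_ iv).
rewrite lcoefZ sD big_ord_recr /= subrK big1 ?add0r.
  by move/eqP; rewrite mulf_eq0 -lead_coefE lead_coef_eq0 (negPf D0) => /eqP.
move=> j _; set k := _ + _; case: (ltP k N) => [/hN ->|Nk]; first by rewrite mulr0.
have jl := ltn_ord j; have e : k = N + `|k - N|%N%:Z by lia.
by rewrite e IH ?mulr0 // /k; lia.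
Qed.

End LaurentLemmas.

(** * Expansion of 1/(z - t) in rising factorials *)

Section Tails.
Variables (K : fieldType) (f : laurent K).
Implicit Types p q : {poly K}.

(* [\phi_f (p(t) / (z - t))] *)
Definition cauchy p : laurent K := lps 1 (fun k => phi f ('X^k * p)).

Lemma cauchyD : {morph cauchy : p q / p + q}.
Proof.
move=> p q; apply/laurent_eqP => -[[|k]|k]; rewrite lcoefD /= ?addr0 //.
by rewrite mulrDr phiD.
Qed.

Lemma cauchyC a p : cauchy (a%:P * p) = a%:P *: cauchy p.
Proof.
apply/laurent_eqP => k; rewrite lcoef_polyCZ; case: k => [[|k]|k] /=; rewrite ?mulr0 //.
by rewrite mulrCA mul_polyC phiZ.
Qed.

(** This is z/(z - t) = t/(z - t) + 1. *)
Lemma cauchyX p : 'X *: cauchy p = cauchy ('X * p) + lpoly (phi f p)%:P.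
Proof.
apply/laurent_eqP => -[k|k]; rewrite lcoef_XZ lcoefD.
  rewrite -PoszD addn1 /= !subSS subn0; case: k => [|k] /=.
    by rewrite expr0 mul1r coefC add0r.
  by rewrite addr0 subSS subn0 exprSr mulrA.
case: k => [|k]; first by rewrite /= coefC addr0.
by rewrite (_ : Negz k.+1 + 1 = Negz k) /= ?coefC ?addr0 //; lia.
Qed.

Lemma phi_extE N (F : {poly {poly K}}) : (size F <= N)%N ->
  phi_ext f F = \sum_(k < N) f k.+1%:Z *: F`_k.
Proof.
move=> sF; rewrite /phi_ext (big_ord_widen _ (fun k => f k.+1%:Z *: F`_k) sF).
rewrite big_mkcond; apply: eq_bigr => k _; case: ltnP => // sk.
by rewrite nth_default // scaler0.
Qed.

Lemma phi_extD : {morph phi_ext f : F G / F + G}.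
Proof.
move=> F G; set N := maxn (size F) (size G).
rewrite !(@phi_extE N) ?leq_maxl ?leq_maxr ?size_polyD // -big_split /=.
by apply: eq_bigr => k _; rewrite coefD scalerDr.
Qed.

Lemma phi_extCM q F : phi_ext f (q%:P * F) = q * phi_ext f F.
Proof.
rewrite (@phi_extE (size F)) ?mul_polyC ?size_scale_leq // big_distrr /=.
by apply: eq_bigr => k _; rewrite coefZ scalerAr.
Qed.

Lemma phi_ext_polyC p : phi_ext f (p^:P) = (phi f p)%:P.
Proof.
rewrite /phi_ext /phi size_map_polyC rmorph_sum /=; apply: eq_bigr => k _.
by rewrite coef_map /= -mul_polyC -polyCM mulrC.
Qed.

Let zt_neq0 : 'X%:P - 'X != 0 :> {poly {poly K}}.
Proof. by rewrite -opprB oppr_eq0 polyXsubC_eq0. Qed.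

Lemma divdiffD : {morph @divdiff K : p q / p + q}.
Proof.
move=> p q; apply: (mulIf zt_neq0); rewrite [RHS]mulrDl !divdiffP !rmorphD.
by rewrite opprD addrACA.
Qed.

Lemma divdiffC (a : K) : divdiff a%:P = 0.
Proof.
by apply: (mulIf zt_neq0); rewrite divdiffP mul0r map_polyC subrr.
Qed.

(** From z p(z) - t p(t) = z (p(z) - p(t)) + (z - t) p(t). *)
Lemma divdiffMX p : divdiff (p * 'X) = 'X%:P * divdiff p + p^:P.
Proof.
apply: (mulIf zt_neq0); rewrite mulrDl -mulrA !divdiffP.
by rewrite polyCM rmorphM /= map_polyX; ring.
Qed.

Lemma divdiffZ (a : K) p : divdiff (a *: p) = a%:P%:P * divdiff p.
Proof.
apply: (mulIf zt_neq0); rewrite -mulrA !divdiffP -mul_polyC polyCM.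
rewrite rmorphM /= map_polyC /=.
by ring.
Qed.

(* [\phi_f ((p(z) - p(t)) / (z - t))] *)
Definition qpart p := phi_ext f (divdiff p).

Lemma phi_ext0 : phi_ext f 0 = 0.
Proof. by rewrite /phi_ext size_poly0 big_ord0. Qed.

Lemma qpartD : {morph qpart : p q / p + q}.
Proof. by move=> p q; rewrite /qpart divdiffD phi_extD. Qed.

Lemma qpartC a : qpart a%:P = 0.
Proof. by rewrite /qpart divdiffC phi_ext0. Qed.

Lemma qpartZ a p : qpart (a *: p) = a%:P * qpart p.
Proof. by rewrite /qpart divdiffZ phi_extCM. Qed.

Lemma qpartMX p : qpart (p * 'X) = 'X * qpart p + (phi f p)%:P.
Proof. by rewrite /qpart divdiffMX phi_extD phi_extCM phi_ext_polyC. Qed.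

(** Splits p(z)/(z - t) as p(t)/(z - t) plus a divided difference; the hypothesis says that f is
    phi_f(1/(z - t)). *)
Lemma scale_cauchy p : cauchy 1 = f -> p *: f = cauchy p + lpoly (qpart p).
Proof.
move=> f1; elim/poly_ind: p => [|p a IH].
  by rewrite scale0r -polyC0 qpartC lpoly0 addr0 -[0%:P]mulr1 cauchyC scale0r.
rewrite scalerDl mulrC -scalerA IH scalerDr cauchyX lpolyXM [in RHS]cauchyD.
have -> : cauchy a%:P = a%:P *: f by rewrite -f1 -cauchyC mulr1.
rewrite qpartD qpartC addr0.
rewrite (mulrC 'X p) qpartMX lpolyD -!addrA; congr (_ + _).
by rewrite addrCA [RHS]addrC addrA.
Qed.

(** Since (z)_(j+1) = (z + j) (z)_j, [qpart] obeys a first-order recurrence that telescopes after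
    division by (z)_(j+1). *)
Lemma qpart_poch j :
  (qpart (poch 'X j))%:F =
  (\sum_(0 <= k < j) (phi f (poch 'X k))%:P%:F / (poch 'X k.+1)%:F) *
  (poch 'X j)%:F :> {fraction {poly K}}.
Proof.
elim: j => [|j IH]; first by rewrite big_nil mul0r poch0 -polyC1 qpartC tofrac0.
rewrite big_nat_recr //= mulrDl divfK ?tofrac_eq0 ?pochX_neq0 //.
have -> : poch 'X j.+1 = poch 'X j * 'X + j%:R *: poch 'X j :> {poly K}.
  by rewrite pochS mulrDr mulr_natr scaler_nat.
rewrite qpartD qpartMX qpartZ -mul_polyC !tofracD !tofracM IH; ring.
Qed.

(** The kernel 1/(z - t) minus its first N terms (t)_k / (z)_(k+1) equals (t)_N / ((z)_N (z -
    t)). *)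
Lemma cauchy_poch_tail N p :
  poch 'X N *: (cauchy p -
    \sum_(0 <= k < N) (phi f (poch 'X k * p))%:P *: linv (poch 'X k.+1)) =
  cauchy (poch 'X N * p).
Proof.
elim: N => [|N IH]; first by rewrite big_nil subr0 poch0 mul1r scale1r.
rewrite big_nat_recr //= opprD addrA scalerBr.
rewrite [X in _ - X]scalerA [_ * _%:P]mulrC -scalerA linvP ?pochX_neq0 // lpolyCM mulr1.
rewrite {1}pochS [_ * ('X + _)]mulrC -scalerA IH scalerDl cauchyX.
rewrite addrAC addrK pochS -polyC_natr -cauchyC -cauchyD; congr cauchy; ring.
Qed.

Lemma lcoef_cauchy_tail N p k : k <= N%:Z ->
  (cauchy p -
    \sum_(0 <= j < N) (phi f (poch 'X j * p))%:P *: linv (poch 'X j.+1)) k = 0.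
Proof.
move=> kN; apply: (@lcoef_eq0_scale _ (poch 'X N) _ 1 (pochX_neq0 _ N)).
  move=> j j1; rewrite cauchy_poch_tail.
  by case: j j1 => [[|j]|j].
by rewrite size_pochX /=; lia.
Qed.

End Tails.

(** * The approximants *)

(** Every Newton coefficient of index at least k survives, up to sign and shift, in the k-th
    difference. *)
Lemma iter_Delta_eq0 (K : fieldType) (charK0 : [pchar K] =i pred0) k (p : {poly K}) :
  iter k (@Delta_m1 K) p = 0 -> (size p <= k)%N.
Proof.
move=> pk0; have [c pE] := newton_exists _ charK0 _ _ (leqnn (size p)).
have c0 i : (k <= i < size p)%N -> c i = 0.
  case/andP=> ki ip; rewrite (newton_coef _ charK0 _ _ _ ip) -pE -(subnK ki) iterD pk0.
  rewrite (_ : iter _ _ 0 = 0) ?horner0 ?mulr0 //.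
  by elim: (i - k)%N => //= e ->; exact: Delta_m1_0.
rewrite pE; apply: (leq_trans (size_sum _ _ _)); apply/bigmax_leqP => i _.
case: (ltnP i k) => ik; last by rewrite c0 ?ik ?ltn_ord // scale0r size_poly0.
do 2![apply: leq_trans (size_scale_leq _ _) _].
by rewrite size_pochX.
Qed.

Section PadeApproximants.
Variable K : fieldType.
Hypothesis charK0 : [pchar K] =i pred0.
Variables (d : nat) (m : 'I_d -> nat) (alpha : 'I_d -> K) (n : nat).

Lemma ApolE l :
  Apol m alpha n l = ((-1) ^+ l / l`!%:R) *: (poch 'X l * Apol m alpha n 0).
Proof.
rewrite /Apol fact0 expr0 (poch0 _ 'X) invr1 scale1r !mul1r.
by rewrite -!mul_polyC polyCM rmorphXn rmorphN1 /=; ring.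
Qed.

Lemma Apol_vanishes l : vanishes _ _ m alpha n (Apol m alpha n l).
Proof.
move=> i c cn; rewrite /Apol (bigD1 i) //= mulrCA dvdp_mulr // dvdp_exp2r //.
rewrite dvdp_mull // dvdpZr ?invr_eq0 ?factr_neq0 //.
by rewrite /poch (bigD1 (Ordinal cn)) //= polyCD polyC_natr addrA dvdp_mulIl.
Qed.

(** The exact degree serves twice: it shows that P is nonzero and bounds its Newton expansion. *)
Lemma size_Apol l :
  size (Apol m alpha n l) = (l + n * \sum_(i < d) (m i).+1).+1.
Proof.
have fact_inv_neq0 k : (k`!%:R)^-1 != 0 :> K by rewrite invr_eq0 factr_neq0.
have size_base i :
    size ((-1) ^+ n * ((n`!%:R)^-1 *: poch ('X + (alpha i)%:P) n)) = n.+1.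
  by rewrite size_Msign size_scale // size_poch.
have base_neq0 i : (-1) ^+ n * ((n`!%:R)^-1 *: poch ('X + (alpha i)%:P) n) != 0.
  by rewrite -size_poly_gt0 size_base.
have prod_neq0 : \prod_(i < d) ((-1) ^+ n *
    ((n`!%:R)^-1 *: poch ('X + (alpha i)%:P) n)) ^+ (m i).+1 != 0.
  by apply/prodf_neq0 => i _; rewrite expf_neq0.
have poch_neq0 : (-1) ^+ l * ((l`!%:R)^-1 *: poch 'X l) != 0 :> {poly K}.
  by rewrite -size_poly_gt0 size_Msign size_scale // size_pochX.
rewrite /Apol size_mul //.
rewrite size_Msign size_scale // size_pochX size_prod; last first.
  by move=> i _; rewrite expf_neq0.
have size_pow i : size (((-1) ^+ n * ((n`!%:R)^-1 *: poch ('X + (alpha i)%:P) n))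
     ^+ (m i).+1) = (n * (m i).+1 + 1)%N.
  rewrite -[LHS]prednK ?size_poly_gt0 ?expf_neq0 //.
  by rewrite size_exp size_base addn1.
under eq_bigr => i _ do rewrite size_pow.
rewrite big_split /= sum1_card -big_distrr /=; lia.
Qed.

(** Each factor is a binomial coefficient through (-1)^e (-a)_e / e! = binom(a, e). *)
Lemma horner_Apol l k :
  (Apol m alpha n l).[- k%:R] =
  'C(k, l)%:R * \prod_(r < d) gbinom (k%:R - alpha r) n ^+ (m r).+1.
Proof.
have neg_poch (a : K) e : (-1) ^+ e * (e`!%:R^-1 * poch (- a) e) = gbinom a e.
  rewrite mulrCA [RHS]mulrC; congr (_ * _).
  rewrite -[X in _ ^+ X](card_ord e) -prodr_const -big_split /=.
  by apply: eq_bigr => i _; rewrite mulN1r opprD opprK.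
have hsign e (x : K) : ((-1) ^+ e : {poly K}).[x] = (-1) ^+ e.
  by rewrite horner_exp hornerN hornerC.
rewrite /Apol !hornerM hsign hornerZ horner_poch hornerX neg_poch.
congr (_ * _).
  rewrite /gbinom; apply: (canLR (mulfK (factr_neq0 _ charK0 l))).
  rewrite -natrM bin_ffact; elim: l => [|l IH]; first by rewrite big_ord0.
  rewrite big_ord_recr /= IH ffactnSr natrM.
  case: (leqP l k) => lk; first by rewrite natrB.
  by rewrite ffact_small // !mul0r.
rewrite horner_prod; apply: eq_bigr => i _.
rewrite horner_exp hornerM hsign hornerZ horner_poch; congr (_ ^+ _).
by rewrite -neg_poch opprB hornerD hornerX hornerC addrC.
Qed.

Lemma horner_Apol_eq0 (d_gt0 : (0 < d)%N) (alpha1 : alpha (Ordinal d_gt0) = 0) l k :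
  (k < n)%N -> (Apol m alpha n l).[- k%:R] = 0.
Proof.
move=> kn; apply/rootP; rewrite -dvdp_XsubCl polyCN opprK.
have := Apol_vanishes l (Ordinal d_gt0) k kn.
by rewrite alpha1 add0r; apply: dvdp_trans; rewrite exprS dvdp_mulIl.
Qed.

Lemma Ppol_shift l :
  Ppol m alpha n l =
  \sum_(0 <= k < n.+1)
     ('C(n, k)%:R * (-1) ^+ (n - k + l) / l`!%:R) *:
     (poch ('X - k%:R) l * (Apol m alpha n 0 \Po ('X - k%:R))).
Proof.
rewrite /Ppol iter_Delta_m1E big_mkord; apply: eq_bigr => k _.
rewrite [in LHS]ApolE comp_polyZ comp_polyM poch_comp comp_polyX scalerA.
by congr (_ *: _); rewrite exprD !mulrA.
Qed.

(** Up to sign, the j-th coefficient is that of A at j + n, an alternating sum of values A(-k). The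
    terms with k < n vanish since alpha_1 = 0, which is why [pcoef] starts at k = n. *)
Lemma Ppol_newton (d_gt0 : (0 < d)%N) (alpha1 : alpha (Ordinal d_gt0) = 0) l :
  Ppol m alpha n l =
  \sum_(j < (l + n * \sum_(i < d) (m i).+1).+1 - n) pcoef m alpha n j l *: rbin K j.
Proof.
rewrite -(size_Apol l) /Ppol; set A := Apol _ _ _ _.
have [c AE] := newton_exists _ charK0 _ _ (leqnn (size A)).
rewrite {1}AE iter_Delta_newton // scaler_sumr; apply: eq_bigr => j _.
rewrite (scalerA ((-1) ^+ n)); congr (_ *: _).
have jn : (j + n < size A)%N by have := ltn_ord j; lia.
rewrite (newton_coef _ charK0 _ _ _ jn) -AE iter_Delta_m1E horner_sum.
rewrite !big_distrr /= /pcoef -(big_mkord xpredT (fun k => (-1) ^+ n *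
  ((-1) ^+ (j + n) * (('C(j + n, k)%:R * (-1) ^+ (j + n - k)) *:
  (A \Po ('X - k%:R))).[0]))).
have hA k : (A \Po ('X - k%:R)).[0] = A.[- k%:R].
  by rewrite horner_comp hornerD hornerN hornerX -polyC_natr hornerC add0r.
rewrite (big_cat_nat _ (n := n)) //=; last by lia.
rewrite big_nat_cond big1 ?add0r => [|k /andP[/andP[_ kn] _]]; last first.
  by rewrite hornerZ hA (horner_Apol_eq0 d_gt0) // !mulr0.
apply: eq_big_nat => k /andP[nk kj].
(* The three signs come from the n differences, from [newton_coef] and from the binomial expansion;
   n + 2(j + n) - k has the parity of n - k. *)
have -> : (-1) ^ (n%:Z - k%:Z) =
    (-1) ^+ n * ((-1) ^+ (j + n) * (-1) ^+ (j + n - k)) :> K.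
  rewrite -opprB subzn // -invr_expz -exprnP invr_sign -!exprD.
  rewrite -signr_odd -[RHS]signr_odd; congr (_ ^+ nat_of_bool _).
  rewrite !oddD !oddB ?oddD //; by case: odd; case: odd; case: odd.
by rewrite hornerZ hA horner_Apol; ring.
Qed.

Lemma Rser_cauchy1 (a : K) s : cauchy K (Rser a s) 1 = Rser a s.
Proof.
apply/laurent_eqP => -[[|k]|k] //.
by rewrite [LHS]/= subn1 mulr1 phiXn.
Qed.

Lemma remainder_cauchy i s l :
  remainder m alpha n i s l = cauchy K (Rser (alpha i) s) (Ppol m alpha n l).
Proof. by rewrite /remainder scale_cauchy ?Rser_cauchy1 // addrK. Qed.

Lemma phi_pochX (a : K) s j :
  phi (Rser a s) (poch 'X j) = (-1) ^+ j.+1 * gser a s j * j`!%:R.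
Proof. by rewrite pochX_rbin // phiZ phi_invMellin_rbin // mulrC. Qed.

Lemma phi_pochX_Ppol (d_gt0 : (0 < d)%N) (alpha1 : alpha (Ordinal d_gt0) = 0) i s l k :
  inI m i s ->
  phi (Rser (alpha i) s) (poch 'X k * Ppol m alpha n l) =
  (k ^_ n)%:R * phi (Rser (alpha i) s) (poch ('X + n%:R) (k - n) * Apol m alpha n l).
Proof.
move=> is_; rewrite -{1}['X]addr0 -(mulr0n 1).
rewrite (phi_poch_iter_Delta _ charK0 _ _ _ d_gt0 alpha1 _ _ is_) //.
exact: Apol_vanishes.
Qed.

End PadeApproximants.

Theorem theorem7p3 (K : fieldType) (charK0 : [pchar K] =i pred0)
    (d : nat) (d_gt0 : (0 < d)%N)
    (m : 'I_d -> nat) (m_gt0 : forall i, (0 < m i)%N)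
    (alpha : 'I_d -> K) (alpha1 : alpha (Ordinal d_gt0) = 0)
    (n l : nat) (M : nat) (M_def : M = (d - 1 + \sum_(i < d) m i)%N)
    (l_leM : (l <= M)%N) :
  [/\ pade_type_approx
        (fun _ : Idx m => n)
        (fun j : Idx m => Rser (alpha (val j).1) (val j).2)
        (Ppol m alpha n l)
        (fun j : Idx m => Qpol m alpha n (val j).1 (val j).2 l),

      Ppol m alpha n l =
        \sum_(0 <= k < n.+1)
           ('C(n, k)%:R * (-1) ^+ (n - k + l) / l`!%:R) *:
           (poch ('X - k%:R) l * (Apol m alpha n 0 \Po ('X - k%:R)))
      /\ Ppol m alpha n l =
        \sum_(0 <= j < (M * n + l).+1)
           (pcoef m alpha n j l / j`!%:R) *: poch 'X j,

      forall (i : 'I_d) (s : nat), inI m i s ->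
        (Qpol m alpha n i s l)%:F =
        \sum_(1 <= j < (M * n + l).+1)
           (pcoef m alpha n j l)%:P%:F *
           (\sum_(0 <= k < j)
              ((-1) ^+ k.+1 * gser (alpha i) s k * k`!%:R)%:P%:F
                / (poch 'X k.+1)%:F) *
           ((poch 'X j)%:F / (j`!%:R)%:F)
           :> {fraction {poly K}}
    & forall (i : 'I_d) (s : nat), inI m i s ->
        laurent_sum n
          (fun k => (k`!%:R / (k - n)`!%:R
                      * phi (Rser (alpha i) s)
                            (poch ('X + n%:R) (k - n) * Apol m alpha n l))%:P
                    *: linv (poch 'X k.+1))
          (remainder m alpha n i s l)].
Proof.
have sumM : (\sum_(i < d) (m i).+1 = M.+1)%N.
  under eq_bigr => i _ do rewrite -addn1.
  by rewrite big_split /= sum1_card card_ord M_def addnC -addSn subn1 prednK.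
have sA := size_Apol _ charK0 _ m alpha n l; rewrite sumM in sA.
have P_newton : Ppol m alpha n l =
    \sum_(0 <= j < (M * n + l).+1) (pcoef m alpha n j l / j`!%:R) *: poch 'X j.
  rewrite (Ppol_newton _ charK0 _ _ _ _ d_gt0 alpha1) sumM big_mkord.
  rewrite (_ : ((l + n * M.+1).+1 - n = (M * n + l).+1)%N); last by lia.
  by apply: eq_bigr => j _; rewrite /rbin scalerA.
have tail_phi i s k : inI m i s -> (n <= k)%N ->
    phi (Rser (alpha i) s) (poch 'X k * Ppol m alpha n l) =
    k`!%:R / (k - n)`!%:R *
      phi (Rser (alpha i) s) (poch ('X + n%:R) (k - n) * Apol m alpha n l).
  move=> is_ nk; rewrite (phi_pochX_Ppol _ charK0 _ _ _ _ d_gt0 alpha1) //.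
  by congr (_ * _); rewrite -(ffact_fact nk) natrM mulfK // factr_neq0.
have head_phi i s k : inI m i s -> (k < n)%N ->
    phi (Rser (alpha i) s) (poch 'X k * Ppol m alpha n l) = 0.
  move=> is_ kn; rewrite (phi_pochX_Ppol _ charK0 _ _ _ _ d_gt0 alpha1) //.
  by rewrite ffact_small // mul0r.
have head_sum i s : inI m i s -> \sum_(0 <= k < n)
    (phi (Rser (alpha i) s) (poch 'X k * Ppol m alpha n l))%:P
      *: linv (poch 'X k.+1) = 0.
  by move=> is_; rewrite big_nat big1 // => k /andP[_ kn]; rewrite head_phi // scale0r.
split.
- split=> [|[[i s] /= is_]].
    (* If P were zero, A would have degree below n, but its degree is l + n(M + 1). *)
    left; apply/eqP => P0; have := iter_Delta_eq0 _ charK0 n _ P0.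
    by rewrite sA; nia.
  apply/ord_inf_geP => k kn; rewrite -[_ - _]/(remainder _ _ _ _ _ _) remainder_cauchy.
  (* The first n terms of the expansion vanish, so the remainder is its own tail and starts at index
     n + 1. *)
  have := lcoef_cauchy_tail K (Rser (alpha i) s) n (Ppol m alpha n l) k.
  by rewrite head_sum // subr0; apply; lia.
- by split; [exact: Ppol_shift | exact: P_newton].
- move=> i s is_; rewrite /Qpol -/(qpart K _ _) P_newton.
  rewrite (big_morph _ (qpartD K _) (_ : _ = 0)); last by rewrite -polyC0 qpartC.
  rewrite (big_morph _ (@tofracD _) (@tofrac0 _)) big_ltn //.
  (* The j = 0 term is constant and has zero divided difference, so the sum starts at 1. *)
  rewrite poch0 qpartZ -polyC1 qpartC mulr0 tofrac0 add0r.
  apply: eq_bigr => j _; rewrite qpartZ tofracM qpart_poch.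
  under eq_bigr => k _ do rewrite phi_pochX //.
  rewrite polyCM tofracM -[j`!%:R in RHS]polyC_natr.
  have -> : (j`!%:R^-1)%:P%:F = (j`!%:R%:P%:F)^-1 :> {fraction {poly K}}.
    exact: (fmorphV (@tofrac {poly K} \o polyC)).
  by ring.
(* The bound n allows splitting off the vanishing head, and |N| makes the tail vanish below index
   N. *)
move=> i s is_ N; exists (maxn n `|N|)%N => N' hN'.
apply/ord_inf_geP => k kN; rewrite remainder_cauchy.
have := lcoef_cauchy_tail K (Rser (alpha i) s) N' (Ppol m alpha n l) k.
rewrite (big_cat_nat _ (n := n)) //=; last by lia.
rewrite head_sum // add0r.
under eq_big_nat => j /andP[nj _] do rewrite tail_phi //.
by apply; lia.
Qed.
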